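(* Let $m,n\in\mathbb{N}$ with $m>n$. Then every finitely generated subsemigroup of the Baumslag--Solitar semigroup $\mathrm{S}(m,n)$ is (right-)automatic.
   Context: $\mathbb{N}$ denotes the set of positive integers. For $m,n\in\mathbb{N}$, the Baumslag--Solitar semigroup $\mathrm{S}(m,n)$ is the semigroup defined by the semigroup presentation with generators $x,y$ and the single defining relation $yx^m=x^ny$. Elements are represented by words over $\{x,y\}$. The empty word is not included in the presented semigroup. For an alphabet $A$, $A^+$ is the set of nonempty words over $A$ and $\varepsilon$ is the empty word. If $A$ is an alphabet representing a set of generators for a semigroup $S$, then for $w\in A^+$, $\overline{w}$ denotes the element of $S$ represented by $w$, and $\overline{W}=\{\overline{w}: w\in W\}$ for $W\subseteq A^+$. Let $\$$ be a symbol not in $A$ and let $A(2,\$)=\{(a,b): a,b\in A\cup\{\$\}\}\setminus\{(\$,\$)\}$, regarded as an alphabet. The map $\delta_A: A^+\times A^+\to A(2,\$)^+$ (written on the right) sends $(u_1\cdots u_p,\,v_1\cdots v_q)$, with $u_i,v_i\in A$, to the word of length $\max(p,q)$ whose $i$-th letter is $(u_i,v_i)$, where $u_i$ is taken to be $\$$ for $i>p$ and $v_i$ is taken to be $\$$ for $i>q$. A right-automatic structure for a semigroup $S$ is a pair $(A,L)$ where $A$ is a finite alphabet representing a set of generators for $S$ and $L\subseteq A^+$ is a regular language with $\overline{L}=S$ such that, for each $a\in A\cup\{\varepsilon\}$, the language $L_a=\{(u,v): u,v\in L,\ \overline{ua}=\overline{v}\}\delta_A$ is regular over $A(2,\$)$.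 A semigroup is right-automatic (or simply automatic) if it admits a right-automatic structure. *)

(* Defs.v *)
From HB Require Import structures.
From mathcomp Require Import all_boot boolp classical_sets.

Set Implicit Arguments.
Unset Strict Implicit.
Unset Printing Implicit Defensive.

Local Open Scope group_scope.
Local Open Scope classical_set_scope.

(* [word A] is A^+, represented by first letter and remaining letters. *)
Record word (A : Type) := Word { whead : A; wtail : seq A }.

Coercion seq_of_word (A : Type) (w : word A) : seq A := whead w :: wtail w.

Definition letter (A : Type) (a : A) : word A := Word a [::].

Definition pair_of_word (A : Type) (w : word A) := (whead w, wtail w).
Definition word_of_pair (A : Type) (p : A * seq A) := Word p.1 p.2.

Lemma pair_of_wordK (A : Type) : cancel (@pair_of_word A) (@word_of_pair A).
Proof. by case. Qed.

HB.instance Definition _ (A : eqType) :=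
  Equality.copy (word A) (can_type (@pair_of_wordK A)).
HB.instance Definition _ (A : choiceType) :=
  Choice.copy (word A) (can_type (@pair_of_wordK A)).

Definition word_mul (A : Type) (u v : word A) : word A :=
  Word (whead u) (wtail u ++ v).

Lemma word_mulA (A : Type) : associative (@word_mul A).
Proof. by move=> [a u] [b v] [c w]; rewrite /word_mul /= -catA. Qed.

HB.instance Definition _ (A : choiceType) :=
  isSemigroup.Build (word A) (@word_mulA A).

Lemma seq_of_wordM (A : choiceType) (u v : word A) : u * v = u ++ v :> seq A.
Proof. by []. Qed.

Inductive congruence (X : choiceType) (R : word X -> word X -> Prop) :
  word X -> word X -> Prop :=
| Congr_rel u v : R u v -> congruence R u v
| Congr_refl u : congruence R u u
| Congr_sym u v : congruence R u v -> congruence R v u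
| Congr_trans u v w : congruence R u v -> congruence R v w -> congruence R u w
| Congr_mul u u' v v' :
    congruence R u u' -> congruence R v v' -> congruence R (u * v) (u' * v').

Section Presentation.
Variables (X : choiceType) (R : word X -> word X -> Prop).

Definition congruenceb : rel (word X) := fun u v => `[< congruence R u v >].

Lemma congruenceb_refl : reflexive congruenceb.
Proof. by move=> u; apply/asboolP; exact: Congr_refl. Qed.

Lemma congruenceb_sym : symmetric congruenceb.
Proof. by move=> u v; apply/asboolP/asboolP; exact: Congr_sym. Qed.

Lemma congruenceb_trans : transitive congruenceb.
Proof.
by move=> v u w /asboolP uv /asboolP vw; apply/asboolP; exact: Congr_trans vw.
Qed.

Canonical congruence_equiv :=
  EquivRel congruenceb congruenceb_refl congruenceb_sym congruenceb_trans.

Local Open Scope quotient_scope.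

Definition presented : Type := {eq_quot congruence_equiv}.

HB.instance Definition _ := Choice.on presented.
HB.instance Definition _ := EqQuotient.on presented.

Definition presented_mul (p q : presented) : presented :=
  \pi_presented (repr p * repr q).

Lemma presented_eqP (u v : word X) :
  \pi_presented u = \pi_presented v <-> congruence R u v.
Proof.
split=> [/eqP | uv]; last apply/eqP.
  by rewrite eqmodE => /asboolP.
by rewrite eqmodE; apply/asboolP.
Qed.

Lemma presented_piM (u v : word X) :
  presented_mul (\pi_presented u) (\pi_presented v) = \pi_presented (u * v).
Proof.
by apply/presented_eqP; apply: Congr_mul; apply/presented_eqP; rewrite reprK.
Qed.

Lemma presented_mulA : associative presented_mul.
Proof.
move=> p q r; rewrite -[p]reprK -[q]reprK -[r]reprK.
by rewrite !presented_piM mulgA !reprK.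
Qed.

HB.instance Definition _ := isSemigroup.Build presented presented_mulA.

End Presentation.

Definition bs_x : bool := false.
Definition bs_y : bool := true.

(* y x^m = x^n y *)
Definition bs_relation (m n : nat) (u v : word bool) : Prop :=
  u = bs_y :: nseq m bs_x :> seq bool /\ v = rcons (nseq n bs_x) bs_y :> seq bool.

Definition baumslag_solitar (m n : nat) : semigroupType :=
  presented (bs_relation m n).

Definition eval (S : semigroupType) (A : Type) (f : A -> S) (w : word A) : S :=
  foldl (fun s a => s * f a) (f (whead w)) (wtail w).

Lemma evalM (S : semigroupType) (A : choiceType) (f : A -> S) :
  {morph eval f : u v / u * v}.
Proof.
move=> u [b v]; rewrite /eval /= foldl_cat /=.
set s := foldl _ _ (wtail u).
by elim/last_ind: v => //= v c IHv; rewrite -!cats1 !foldl_cat /= IHv mulgA.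
Qed.

Definition generating (S : semigroupType) (A : Type) (f : A -> S) : Prop :=
  forall s : S, exists w : word A, eval f w = s.

Definition finitely_generated (S : semigroupType) : Prop :=
  exists (A : finType) (f : A -> S), generating f.

Record dfa (A : finType) := Dfa {
  dfa_state : finType;
  dfa_init : dfa_state;
  dfa_final : {set dfa_state};
  dfa_step : dfa_state -> A -> dfa_state }.

Definition dfa_lang (A : finType) (M : dfa A) : set (seq A) :=
  [set w | foldl (@dfa_step A M) (dfa_init M) w \in dfa_final M].

Definition regular (A : finType) (L : set (seq A)) : Prop :=
  exists M : dfa A, L = dfa_lang M.

(* The alphabet A(2,$), with [None] in the role of $. *)
Definition padded (A : finType) : finType :=
  {p : option A * option A | p != (None, None)}.

Definition pad_both (A : finType) (a b : A) : padded A :=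
  exist _ (Some a, Some b) isT.
Definition pad_left (A : finType) (a : A) : padded A :=
  exist _ (Some a, None) isT.
Definition pad_right (A : finType) (b : A) : padded A :=
  exist _ (None, Some b) isT.

Fixpoint convolution (A : finType) (u v : seq A) : seq (padded A) :=
  match u, v with
  | a :: u', b :: v' => pad_both a b :: convolution u' v'
  | _, [::] => map (@pad_left A) u
  | [::], _ => map (@pad_right A) v
  end.

Lemma convolutionE (A : finType) (u v : seq A) :
  map val (convolution u v) =
  mkseq (fun i => (onth u i, onth v i)) (maxn (size u) (size v)).
Proof.
have mkseqS (T : Type) (g : nat -> T) k :
  mkseq g k.+1 = g 0%N :: mkseq (g \o succn) k.
  by rewrite /mkseq /= -[1%N]/(1 + 0)%N iotaDl -map_comp.
elim: u v => [|a u IHu] [|b v] //=.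
- rewrite max0n mkseqS /=; congr cons.
  by elim: v => //= c v IHv; rewrite mkseqS IHv.
- rewrite maxn0 mkseqS /=; congr cons.
  by elim: u {IHu} => //= c u IHu; rewrite mkseqS IHu.
- by rewrite maxnSS mkseqS IHu.
Qed.

(* L_a for a in A, when [a] is [Some _]; L_epsilon when [a] is [None]. *)
Definition mul_language (S : semigroupType) (A : finType) (f : A -> S)
    (L : set (word A)) (a : option A) : set (seq (padded A)) :=
  [set z | exists u v : word A,
    [/\ L u, L v,
        eval f (if a is Some b then u * letter b else u) = eval f v &
        z = convolution u v]].

Record right_automatic_structure (S : semigroupType) (A : finType) (f : A -> S)
    (L : set (word A)) : Prop := RightAutomaticStructure {
  ras_generating : generating f;
  ras_regular : regular [set (w : seq A) | w in L];
  ras_onto : [set eval f w | w in L] = setT;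
  ras_mul : forall a : option A, regular (mul_language f L a) }.

Definition right_automatic (S : semigroupType) : Prop :=
  exists (A : finType) (f : A -> S) (L : set (word A)),
    right_automatic_structure f L.

(* Main.v *)
Require Import Defs.
From mathcomp Require Import all_boot boolp classical_sets zify.

Set Implicit Arguments.
Unset Strict Implicit.
Unset Printing Implicit Defensive.

(** Read a word over {x, y} from right to left with a counter c: a letter x
    increments c; a letter y emits the digit c mod m and replaces c by
    n * (c div m).  The final counter c and the emitted digits d_1, ..., d_k are
    those of the normal form x^c y x^d_1 ... y x^d_k, so they determine the
    element of S(m,n) ([act_congruence], [act_origin_inj]).  As n < m, each y
    shrinks the counter by a factor n/m ([act_contract]), so over a finite
    alphabet the counter stays bounded as long as every letter contains a y:
    only a block of pure powers of x can make it large.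

    Let T be a finitely generated subsemigroup and let the height of an element
    be its number of letters y.  If g has height h, then
    g x^(m^h i) = x^(n^h i) g.  Hence a large power of x lying in T moves to the
    left of any generator of positive height without leaving T, and every
    element of T is x^e c, where x^e is 1 or lies in T and c is a product of
    letters of positive height from a fixed finite set ([normal_form]).  If some
    x^p with p > 0 lies in T, then x^e = (x^p)^N x^e' with e' bounded, and only
    the letter x^p is repeated an unbounded number of times ([cross_section]).

    The letters of c are regrouped so that the last k letters have
    height k H up to an error H.  Consequently, if u a = v with u and v in this
    language, the numbers of letters x^p and of letters of positive height in u
    and in v agree up to constants.  Read the pair (u, v) from right to left.  At
    a given position both counters, and the digits that one word has emitted and
    the other has not, are bounded ([carry_bound], [overhang_bound]), unless
    both words are inside their powers of x; there both still read the same
    letters x^p, so their configurations must coincide ([matched_powers]).  So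
    there are finitely many classes of suffixes with respect to the contexts on
    their left ([regular_equality]), and this makes a language regular
    ([regular_left_classes]). *)

(** * The normal form of S(m,n) as the output of a transducer *)

Section Transducer.
Variables m n : nat.

(** A counter and the digits emitted so far, the last one first. *)
Definition config : Type := nat * seq nat.
Definition origin : config := (0, [::]).

Definition step (b : bool) (s : config) : config :=
  if b then (n * (s.1 %/ m), s.1 %% m :: s.2) else (s.1.+1, s.2).

Definition act (w : seq bool) (s : config) : config := foldr step s w.

Definition height (w : seq bool) : nat := count_mem bs_y w.

Lemma act_cat u v s : act (u ++ v) s = act u (act v s).
Proof. exact: foldr_cat. Qed.

(** The digits already emitted are never read again. *)
Lemma act_frame w c ds :
  act w (c, ds) = ((act w (c, [::])).1, (act w (c, [::])).2 ++ ds).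
Proof. by elim: w => //= b w ->; case: b. Qed.

Lemma size_act w s : size (act w s).2 = height w + size s.2.
Proof. by elim: w => //= -[] w /= ->. Qed.

Lemma act_xs w s : height w = 0 -> act w s = (s.1 + size w, s.2).
Proof.
elim: w => [|[] w IHw] //=; first by rewrite addn0 -surjective_pairing.
by rewrite /height /= => /IHw ->; rewrite addnS.
Qed.

Lemma act_nseq k s : act (nseq k bs_x) s = (s.1 + k, s.2).
Proof. by rewrite act_xs ?size_nseq // /height count_nseq. Qed.

Lemma act_eq_origin w : act w origin = origin -> w = [::].
Proof.
move=> E; have hw : height w = 0.
  by have := size_act w origin; rewrite E addn0.
by move: E; rewrite act_xs // => -[/size0nil].
Qed.

Hypothesis m_gt0 : 0 < m.

Lemma act_digits w s :
  all (fun d => d < m) s.2 -> all (fun d => d < m) (act w s).2.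
Proof.
by move=> s_ltm; elim: w => //= -[] w IHw //=; rewrite ltn_pmod.
Qed.

(** The counter form of w x^(m^h i) = x^(n^h i) w for a word w of height h: each
    of the h letters y divides the excess by m and multiplies it by n, and no
    digit sees it. *)
Lemma act_shift w c ds i :
  act w (c + m ^ height w * i, ds) =
  ((act w (c, ds)).1 + n ^ height w * i, (act w (c, ds)).2).
Proof.
elim: w i => [|[] w IHw] i /=; first by rewrite !mul1n.
  rewrite /height /= -/(height w) add1n !expnS.
  have -> : m * m ^ height w * i = m ^ height w * (m * i) by lia.
  rewrite IHw /=; set c1 := (act w (c, ds)).1.
  have -> : c1 + n ^ height w * (m * i) = (n ^ height w * i) * m + c1 by lia.
  by rewrite divnMDl // modnMDl; congr (_, _); lia.
by rewrite /height /= add0n IHw.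
Qed.

Hypothesis lt_nm : n < m.

Lemma act_le w s : (act w s).1 <= s.1 + size w.
Proof.
elim: w => [|[] w IHw] /=; [by rewrite addn0| |by rewrite addnS].
apply: leq_trans (_ : (act w s).1 <= _); last lia.
have := leq_trunc_div (act w s).1 m; nia.
Qed.

(** One letter y already gains the factor n/m.  With n < m, any bound C at least
    2 * m * size w on the counter is therefore preserved by w. *)
Lemma act_contract w s :
  0 < height w -> m * (act w s).1 <= n * s.1 + 2 * m * size w.
Proof.
elim: w => [|[] w IHw] //= hw.
  have := act_le w s; have := leq_trunc_div (act w s).1 m.
  set c := (act w s).1; set q := c %/ m => h1 h2.
  have : m * (n * q) <= n * c by nia.
  nia.
have := IHw hw; nia.
Qed.

End Transducer.

Section NormalForm.
Variables (m n : nat).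
Hypotheses (m_gt0 : 0 < m).
Local Notation act := (act m n).
Local Notation R := (bs_relation m n).

(** Both sides of y x^m = x^n y add n to the counter after the division. *)
Lemma act_congruence u v : congruence R u v -> act u =1 act v.
Proof.
elim=> {u v} [u v [-> ->]|u|u v _ IH|u v w _ IHu _ IHv|u u' v v' _ IHu _ IHv] s //.
- rewrite -cats1 act_cat act_nseq [LHS]/= -/(act _ _) act_nseq /=.
  by rewrite divnDr // divnn m_gt0 modnDr mulnDr muln1.
- by rewrite IHu.
- by rewrite !seq_of_wordM !act_cat IHv IHu.
Qed.

Lemma seq_of_word_inj : injective (@seq_of_word bool).
Proof. by move=> [a u] [b v] [-> ->]. Qed.

(** The congruence on possibly empty words, the empty word being related only to
    itself: intermediate words in a computation may be empty. *)
Definition similar (u v : seq bool) : Prop :=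
  u = v \/ exists U V : word bool, [/\ u = U, v = V & congruence R U V].

Lemma similar_trans u v w : similar u v -> similar v w -> similar u w.
Proof.
case=> [-> //|[U [V [-> -> UV]]]] [<-|[V' [W [/seq_of_word_inj <- -> VW]]]].
  by right; exists U, V.
by right; exists U, W; split=> //; apply: Congr_trans VW.
Qed.

Lemma similar_frame p q u v : similar u v -> similar (p ++ u ++ q) (p ++ v ++ q).
Proof.
case=> [-> |[U [V [-> -> UV]]]]; [by left | right].
have [C [D [EC ED CD]]] : exists C D : word bool,
    [/\ U ++ q = C, V ++ q = D & congruence R C D].
  case: q => [|b q]; first by exists U, V; rewrite !cats0.
  exists (U * Word b q)%g, (V * Word b q)%g; split=> //.
  by apply: Congr_mul => //; apply: Congr_refl.
rewrite EC ED; case: p => [|b p]; first by exists C, D.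
exists (Word b p * C)%g, (Word b p * D)%g; split=> //.
by apply: Congr_mul => //; apply: Congr_refl.
Qed.

Lemma similar_relation : similar (bs_y :: nseq m bs_x) (nseq n bs_x ++ [:: bs_y]).
Proof.
pose V := if nseq n bs_x is b :: s then Word b (s ++ [:: bs_y]) else letter bs_y.
have EV : V = nseq n bs_x ++ [:: bs_y] :> seq bool by rewrite /V; case: nseq.
right; exists (Word bs_y (nseq m bs_x)), V; split=> //.
by apply: Congr_rel; split=> //; rewrite EV cats1.
Qed.

Lemma similar_slide k d q :
  similar (bs_y :: nseq (k * m + d) bs_x ++ q)
          (nseq (n * k) bs_x ++ bs_y :: nseq d bs_x ++ q).
Proof.
elim: k => [|k IHk]; first by rewrite muln0; left.
have := similar_frame [::] (nseq (k * m + d) bs_x ++ q) similar_relation.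
rewrite /= catA -nseqD addnA -mulSn -catA /= => /similar_trans; apply.
have := similar_frame (nseq n bs_x) [::] IHk.
by rewrite !cats0 catA -nseqD -mulnS.
Qed.

Definition word_of_config (s : config) : seq bool :=
  nseq s.1 bs_x ++ flatten [seq bs_y :: nseq d bs_x | d <- s.2].

Lemma similar_act w : similar w (word_of_config (act w origin)).
Proof.
elim: w => [|b w IHw]; first by left.
have := similar_frame [:: b] [::] IHw; rewrite !cats0 => /similar_trans; apply.
rewrite /=; set s := act w origin; case: b; last by left.
rewrite /word_of_config /= {1}(divn_eq s.1 m).
exact: similar_slide.
Qed.

(** A word is congruent to the word spelled by its output configuration
    ([similar_act]), so equal outputs give congruent words. *)
Lemma act_origin_inj (U V : word bool) :
  act U origin = act V origin -> congruence R U V.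
Proof.
move=> E; have := similar_act U; have := similar_act V; rewrite -E.
set N := word_of_config _ => V_N U_N.
have : similar U V.
  apply: similar_trans U_N _; case: V_N => [->|[C [D [-> -> CD]]]]; first by left.
  by right; exists D, C; split=> //; apply: Congr_sym.
case=> [/seq_of_word_inj -> |[U' [V' [/seq_of_word_inj -> /seq_of_word_inj ->]]]] //.
exact: Congr_refl.
Qed.

End NormalForm.

(** * Regularity from finitely many classes of suffixes *)

Section Regularity.
Variables (A : finType) (L : set (seq A)) (Q : eqType) (kappa : seq A -> Q).
Variable s : seq Q.
Hypothesis kappa_bounded : forall z w, L (z ++ w) -> kappa w \in s.
Hypothesis kappa_subst : forall y z w w',
  L (y ++ w') -> kappa w = kappa w' -> L (z ++ w) -> L (z ++ w').

(** The state of the automaton after the prefix z. *)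
Let tests (z : seq A) : {set 'I_(size s)} :=
  [set k : 'I_(size s) |
    `[< exists2 w, kappa w = tnth (in_tuple s) k & L (z ++ w) >]].

Let tests_subst z z' w : tests z = tests z' -> L (z ++ w) -> L (z' ++ w).
Proof.
move=> zz' Lzw; have /(nthP (kappa w)) [k lt_k E] := kappa_bounded Lzw.
have : Ordinal lt_k \in tests z.
  rewrite inE; apply/asboolP; exists w => //.
  by rewrite (tnth_nth (kappa w)) /= E.
rewrite zz' inE => /asboolP[w' Ew' Lz'w'].
apply: (kappa_subst Lzw) Lz'w'.
by rewrite Ew' (tnth_nth (kappa w)) /= E.
Qed.

(** A Myhill-Nerode criterion for contexts on the left: [kappa] takes finitely
    many values on the suffixes of words of L, and equal values allow one
    suffix to replace another.  The class of a prefix z is then determined by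
    the set of values of the suffixes w with z w in L; these sets are the states
    of a deterministic automaton reading from the left. *)
Lemma regular_left_classes : regular L.
Proof.
pose witness K := xget [::] [set z | tests z = K]%classic.
pose M := Dfa (tests [::]) [set K | `[< L (witness K) >]]
              (fun K a => tests (rcons (witness K) a)).
have witnessP z : tests (witness (tests z)) = tests z.
  exact: (@xgetI _ [::] [set y | tests y = tests z]%classic z).
have run z w : foldl (@dfa_step _ M) (tests z) w = tests (z ++ w).
  elim: w z => [|a w IHw] z /=; first by rewrite cats0.
  rewrite -cat_rcons -IHw; congr foldl.
  apply/setP=> k; rewrite !inE; apply/asboolP/asboolP => -[v Ev];
    rewrite cat_rcons => Lv; exists v => //; rewrite cat_rcons;
    exact: tests_subst Lv.
exists M; apply/seteqP; split=> w; rewrite /dfa_lang /= run inE.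
  move=> Lw; apply/asboolP; rewrite -[witness _]cats0.
  by apply: (@tests_subst w); rewrite ?witnessP ?cats0.
move=> /asboolP Lw; rewrite -[w]cats0; apply: (@tests_subst (witness (tests w))).
  exact: witnessP.
by rewrite cats0.
Qed.

End Regularity.

Section Convolution.
Variable A : finType.
Implicit Types (u v : seq A) (z w : seq (padded A)).

Definition track1 w : seq A := pmap (fun c => (val c).1) w.
Definition track2 w : seq A := pmap (fun c => (val c).2) w.

Definition is_convolution w : bool := w == convolution (track1 w) (track2 w).

Lemma track1_cat z w : track1 (z ++ w) = track1 z ++ track1 w.
Proof. exact: pmap_cat. Qed.

Lemma track2_cat z w : track2 (z ++ w) = track2 z ++ track2 w.
Proof. exact: pmap_cat. Qed.

Lemma track1_convolution u v : track1 (convolution u v) = u.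
Proof.
elim: u v => [|a u IHu] [|b v] //=; rewrite ?IHu //.
  by elim: v.
by congr cons; elim: u {IHu} => //= a' u ->.
Qed.

Lemma track2_convolution u v : track2 (convolution u v) = v.
Proof.
elim: u v => [|a u IHu] [|b v] //=; rewrite ?IHu //.
  by congr cons; elim: v => //= b' v ->.
by elim: u {IHu}.
Qed.

(** In a convolution, padding on a track is never followed by a letter of that
    track. *)
Lemma is_convolution_cons c w : is_convolution (c :: w) =
  [&& is_convolution w, ((val c).1 == None) ==> (track1 w == [::])
    & ((val c).2 == None) ==> (track2 w == [::])].
Proof.
have eq_padded (x y : padded A) (v v' : seq (padded A)) :
    (x :: v == y :: v') = (val x == val y) && (v == v') by rewrite eqseq_cons.
rewrite /is_convolution; case: c => -[[a|] [b|]] //= nz.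
- by rewrite eq_padded /= eqxx !andbT.
- case: (track2 w) => [|b v] /=.
    by rewrite eq_padded /= eqxx !andbT; case: (track1 w).
  by rewrite eq_padded xpair_eqE /= !andbF.
- case: (track1 w) => [|a u] /=.
    by rewrite eq_padded /= eqxx !andbT; case: (track2 w).
  by rewrite eq_padded xpair_eqE /= !andbF.
Qed.

Lemma is_convolution_catr z w : is_convolution (z ++ w) -> is_convolution w.
Proof. by elim: z => //= c z IHz; rewrite is_convolution_cons => /andP[/IHz]. Qed.

(** All that a prefix can see of a suffix is whether each of its tracks is
    empty. *)
Lemma is_convolution_subst z w w' :
  is_convolution w' ->
  (track1 w == [::]) = (track1 w' == [::]) ->
  (track2 w == [::]) = (track2 w' == [::]) ->
  is_convolution (z ++ w) -> is_convolution (z ++ w').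
Proof.
move=> Cw' E1 E2; elim: z => //= c z IHz.
have nil_cat (T : eqType) (p q : seq T) :
  (p ++ q == [::]) = (p == [::]) && (q == [::]) by case: p.
rewrite !is_convolution_cons !track1_cat !track2_cat !nil_cat E1 E2.
by case/and3P=> /IHz -> -> ->.
Qed.

Lemma size_track1 z : size (track1 z) <= size z.
Proof. by rewrite size_pmap count_size. Qed.

Lemma size_track2 z : size (track2 z) <= size z.
Proof. by rewrite size_pmap count_size. Qed.

Lemma size_track1_full z w : is_convolution (z ++ w) -> track1 w != [::] ->
  size (track1 z) = size z.
Proof.
move=> + nz; elim: z => //= c z IHz; rewrite is_convolution_cons track1_cat.
case/and3P=> /IHz E + _; rewrite /track1 /= -/(track1 z).
case: (val c).1 => [a _|] /=; first by rewrite E.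
by case: (track1 z) => //=; rewrite (negPf nz).
Qed.

Lemma size_track2_full z w : is_convolution (z ++ w) -> track2 w != [::] ->
  size (track2 z) = size z.
Proof.
move=> + nz; elim: z => //= c z IHz; rewrite is_convolution_cons track2_cat.
case/and3P=> /IHz E _; rewrite /track2 /= -/(track2 z).
case: (val c).2 => [a _|] /=; first by rewrite E.
by case: (track2 z) => //=; rewrite (negPf nz).
Qed.

End Convolution.

Fixpoint digit_words (m k : nat) : seq (seq nat) :=
  if k is k'.+1
  then [::] :: [seq d :: e | d <- iota 0 m, e <- digit_words m k']
  else [:: [::]].

Lemma mem_digit_words m k e :
  (e \in digit_words m k) = (size e <= k) && all (fun d => d < m) e.
Proof.
elim: k e => [|k IHk] [|d e] //=; rewrite in_cons /=.
apply/allpairsP/idP => [[[d' e'] /= []]|/and3P[lek ltd alle]].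
  by rewrite mem_iota IHk => /= ltd /andP[lek alle] [-> ->]; rewrite ltnS lek ltd.
by exists (d, e); rewrite mem_iota IHk /= alle andbT; split.
Qed.

(** * Admissible words and the comparison of two of them *)

Section BalancedWords.
Variables (A : finType) (spelling : A -> seq bool) (p H : nat).
Implicit Types (a b : A) (u v w : seq A) (s t : config).

Definition spell u : seq bool := flatten (map spelling u).

Definition is_power a : bool := height (spelling a) == 0.
Definition is_base a : bool := is_power a && (size (spelling a) == p).

Definition balanced u : bool :=
  (height (spell u) <= (size u).+1 * H) && (size u * H <= height (spell u) + H).

Definition starts_with_power u : bool := if u is a :: _ then is_power a else false.

(** An admissible word is z^N zeta c, where z is a letter spelling x^p, zeta is
    at most one further power of x, and every suffix of c is balanced.  The last
    condition below says that only z may stand to the left of a power of x;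
    with it, balance is needed only at letters of positive height. *)
Fixpoint admissible u : bool :=
  if u is a :: u' then
    [&& admissible u', is_power a || balanced u & starts_with_power u' ==> is_base a]
  else true.

Local Notation powers := (count is_power).
Local Notation syllables := (count (predC is_power)).

Lemma spell_cat u v : spell (u ++ v) = spell u ++ spell v.
Proof. by rewrite /spell map_cat flatten_cat. Qed.

Lemma height_cat (x y : seq bool) : height (x ++ y) = height x + height y.
Proof. exact: count_cat. Qed.

Lemma spell_cons a u : spell (a :: u) = spelling a ++ spell u.
Proof. by []. Qed.

Lemma admissible_catr u v : admissible (u ++ v) -> admissible v.
Proof. by elim: u => //= a u IHu /and3P[/IHu]. Qed.

Lemma admissible_syllables a u : admissible (a :: u) -> ~~ is_power a -> powers u = 0.
Proof.
elim: u a => // b u IHu a /= /and3P[gu _ E] pos_a.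
have pos_b : ~~ is_power b.
  by apply: contra pos_a => /(implyP E) /andP[].
by rewrite (negPf pos_b) (IHu b).
Qed.

Lemma admissible_powers u v : admissible (u ++ v) -> 0 < powers v -> all is_base u.
Proof.
move=> + v_gt0; elim: u => //= a u IHu /and3P[guv _ /implyP E].
rewrite IHu // andbT; apply: E.
case: u IHu guv => [_|b u /[apply] /= /andP[/andP[]] //].
case: v v_gt0 => //= b v v_gt0 gv.
apply/negP => /negP pos_b.
by move: v_gt0; rewrite (negPf pos_b) (admissible_syllables gv).
Qed.

Lemma powers_syllables u : powers u + syllables u = size u.
Proof. exact: count_predC. Qed.

(** The powers of x contribute neither to the height nor to the count. *)
Lemma admissible_height u : admissible u ->
  height (spell u) <= syllables u * H + H /\
  syllables u * H <= height (spell u) + H.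
Proof.
elim: u => [|a u IHu] //=.
move=> gau; have /and3P[gu bal _] := gau.
have [pow_a|pos_a] := boolP (is_power a).
  by rewrite spell_cons height_cat (eqP pow_a) /= !add0n; apply: IHu.
move: bal; rewrite (negPf pos_a) /= => /andP[/= h1 h2].
have := powers_syllables u; rewrite (admissible_syllables gau pos_a) => E.
split; lia.
Qed.

Lemma admissible_balanced u : admissible u -> ~~ starts_with_power u ->
  height (spell u) <= size u * H + H /\ size u * H <= height (spell u) + H.
Proof.
move=> gu nu; suff E : syllables u = size u by rewrite -E; apply: admissible_height.
case: u gu nu => //= a u gau pos_a.
by rewrite pos_a -(powers_syllables u) (admissible_syllables gau).
Qed.

(** What a prefix sees of an admissible suffix u: its first letter, and the
    deviation of its height from size u * H, shifted by H to be a natural number.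
    Once u starts with a power of x, no height to its left is constrained. *)
Definition admissible_class u : option A * nat :=
  (ohead u,
   if starts_with_power u then 0 else height (spell u) + H - size u * H).

Definition admissible_classes : seq (option A * nat) :=
  [seq (h, d) | h <- enum {: option A}, d <- iota 0 (2 * H).+1].

(** On admissible words, balance bounds the defect recorded by
    [admissible_class]. *)
Lemma admissible_class_bounded u :
  admissible u -> admissible_class u \in admissible_classes.
Proof.
move=> gu; apply/allpairsP; exists (admissible_class u); split=> //.
  by rewrite mem_enum.
rewrite mem_iota /=; case: ifPn => // nu.
have [] := admissible_balanced gu nu; lia.
Qed.

Lemma admissible_subst z w w' :
  admissible w' -> admissible_class w = admissible_class w' ->
  admissible (z ++ w) -> admissible (z ++ w').
Proof.
move=> gw' [Ehead Edefect] gzw; have gw := admissible_catr gzw.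
have swpE v v' : ohead v = ohead v' -> starts_with_power v = starts_with_power v'.
  by case: v v' => [|a v] [|a' v'] //= [->].
pose same v v' := [/\ admissible v', ohead v = ohead v' & ~~ starts_with_power v ->
  height (spell v) + size v' * H = height (spell v') + size v * H].
suff [] : same (z ++ w) (z ++ w') by [].
elim: z gzw => [_|a z IHz /= /and3P[/IHz [IH1 IH2 IH3] bal base_a]].
  split=> // nw; have nw' : ~~ starts_with_power w' by rewrite -(swpE w).
  have [h1 h2] := admissible_balanced gw nw; have [h3 h4] := admissible_balanced gw' nw'.
  move: Edefect; rewrite (negPf nw) (negPf nw') /=; lia.
rewrite /= in IH1 IH2 IH3; have base_a' := base_a; rewrite (swpE _ _ IH2) in base_a'.
have [pow_a|pos_a] := boolP (is_power a).
  by split=> //=; rewrite ?IH1 ?base_a' pow_a.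
have nzw : ~~ starts_with_power (z ++ w).
  by apply: contra pos_a => /(implyP base_a) /andP[].
have {}IH3 := IH3 nzw.
split=> //=; last by rewrite !spell_cons !height_cat; lia.
rewrite IH1 base_a' (negPf pos_a) andbT /=.
by move: bal; rewrite (negPf pos_a) /= /balanced !spell_cons !height_cat /=; lia.
Qed.

Lemma regular_admissible : regular [set u | u != [::] /\ admissible u]%classic.
Proof.
apply: (@regular_left_classes _ _ _ admissible_class admissible_classes).
  by move=> z w [_ /admissible_catr]; apply: admissible_class_bounded.
move=> y z w w' [_ /admissible_catr gw'] E [nzw gzw].
split; last exact: admissible_subst gzw.
by case: E => + _; case: z nzw {gzw} => // ; case: w w' {gw'} => [|a w] [].
Qed.

Variables m n : nat.
Local Notation act := (act m n).

Lemma act_base u s : all is_base u -> act (spell u) s = (s.1 + p * size u, s.2).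
Proof.
elim: u => [|a u IHu] /=; first by rewrite muln0 addn0 -surjective_pairing.
case/andP=> /andP[/eqP ha /eqP szp] /IHu E.
by rewrite spell_cons act_cat E act_xs //= szp mulnS; congr (_, _); lia.
Qed.

Hypotheses (m_gt0 : 0 < m) (lt_nm : n < m) (p_gt0 : 0 < p) (H_gt0 : 0 < H).

Section Carry.
Variable C : nat.
Hypothesis spelling_le : forall a, 2 * m * size (spelling a) <= C.

(** The letters of positive height leave a counter at most C, the single power
    that is not x^p adds at most C, and each other power adds exactly p. *)
Lemma admissible_carry u s : admissible u -> s.1 <= C ->
  [/\ powers u = 0 -> (act (spell u) s).1 <= C,
      (act (spell u) s).1 <= 2 * C + p * powers u &
      p * powers u <= (act (spell u) s).1 + p].
Proof.
move=> + sC; elim: u => [_|a u IHu] /=; first by split=> //; lia.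
move=> gau; have /and3P[gu _ /implyP base_a] := gau.
have [IH1 IH2 IH3] := IHu gu.
have size_a : size (spelling a) <= C by have := spelling_le a; nia.
rewrite spell_cons act_cat.
have [pow_a|pos_a] := boolP (is_power a).
  rewrite act_xs /=; last exact/eqP.
  case: u gau gu base_a IHu IH1 IH2 IH3 => [|b u] gau gu base_a _.
    by rewrite /= => _ _ _; split=> //; lia.
  have [pow_b|pos_b] := boolP (is_power b).
    move=> _ IH2 IH3; have /andP[_ /eqP ->] := base_a pow_b.
    by rewrite add1n mulnS; split=> //; lia.
  rewrite /= (negPf pos_b) (admissible_syllables gu pos_b) /=.
  by move=> /(_ erefl) IH1 _ _; split=> //; lia.
rewrite (admissible_syllables gau pos_a) /= muln0.
have {}IH1 := IH1 (admissible_syllables gau pos_a).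
suff: (act (spelling a) (act (spell u) s)).1 <= C by split=> //; lia.
have h_gt0 : 0 < height (spelling a) by rewrite lt0n.
have := act_contract m_gt0 lt_nm (act (spell u) s) h_gt0.
have := spelling_le a; nia.
Qed.

(** Equal outputs have equal heights, which controls the number of letters of
    positive height, and equal counters, which control the number of powers. *)
Lemma lengths_close u v s t :
  admissible u -> admissible v -> s.1 <= C -> t.1 <= C ->
  act (spell u) s = act (spell v) t ->
  syllables u <= syllables v + (2 + size t.2) /\
  powers u <= powers v + (2 * C + 1).
Proof.
move=> gu gv sC tC E; split.
  have := congr1 (fun x => size x.2) E; rewrite !size_act => Eh.
  have [_ hu] := admissible_height gu; have [hv _] := admissible_height gv.
  have hts : size t.2 <= size t.2 * H by rewrite leq_pmulr.
  by rewrite -(leq_pmul2r H_gt0) !mulnDl; lia.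
have [_ _ lo] := admissible_carry gu sC; have [_ hi _] := admissible_carry gv tC.
rewrite -E in hi.
have Cp : C <= C * p by rewrite leq_pmulr.
by rewrite -(leq_pmul2l p_gt0) !mulnDr; lia.
Qed.

(** Suffixes u2 and v2 found at the same position of the convolution of u1 u2
    and v1 v2; their prefixes may differ in length only when one of the suffixes
    lies entirely in the padding. *)
Definition matched u1 u2 v1 v2 s t : Prop :=
  [/\ admissible (u1 ++ u2), admissible (v1 ++ v2), v2 != [::] -> size u1 <= size v1,
      u2 != [::] -> size v1 <= size u1 &
      act (spell (u1 ++ u2)) s = act (spell (v1 ++ v2)) t].

Lemma matched_sym u1 u2 v1 v2 s t :
  matched u1 u2 v1 v2 s t -> matched v1 v2 u1 u2 t s.
Proof. by case. Qed.

Variable D : nat.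
Let K := 3 + 2 * C + D.

Definition small s : Prop := s.1 <= C /\ size s.2 <= D.

(** The whole words have close lengths and the prefixes match, so the suffixes
    have close lengths.  If v2 consists of letters of positive height, their number
    is its length; otherwise v2 contains all such letters of the word. *)
Lemma suffixes_close u1 u2 v1 v2 s t :
  small s -> small t -> matched u1 u2 v1 v2 s t ->
  size u2 <= size v2 + K /\ syllables u2 <= syllables v2 + K.
Proof.
move=> [sC sD] [tC tD] [gu gv uv vu E].
have [h1 h2] := lengths_close gu gv sC tC E.
have := powers_syllables (u1 ++ u2); have := powers_syllables (v1 ++ v2).
have := powers_syllables u2; have := powers_syllables v2.
have := powers_syllables v1.
move: h1 h2; rewrite !count_cat !size_cat => h1 h2 Ev1 Ev2 Eu2 Ev Eu.
have hsize : size u2 <= size v2 + K.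
  by case: (u2 =P [::]) => [-> //|/eqP /vu vu']; rewrite /K; lia.
split=> //.
have [v2_0|v2_gt0] := posnP (powers v2); first by rewrite /K in hsize *; lia.
have : powers v1 = size v1.
  apply/eqP; rewrite -all_count; apply: sub_all (admissible_powers gv v2_gt0).
  by move=> a /andP[].
rewrite /K in hsize *; lia.
Qed.

Lemma overhang_bound u1 u2 v1 v2 s t :
  small s -> small t -> matched u1 u2 v1 v2 s t ->
  size (act (spell u2) s).2 - size (act (spell v2) t).2 <= (K + 2) * H + D.
Proof.
move=> ss st M; have [_ hs] := suffixes_close ss st M.
case: M => gu gv _ _ _; rewrite !size_act.
have [h1 _] := admissible_height (admissible_catr gu).
have [_ h2] := admissible_height (admissible_catr gv).
case: ss => _ sD; move: hs; rewrite -(leq_pmul2r H_gt0) !mulnDl; lia.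
Qed.

(** If one of the suffixes has no power of x, the other has boundedly many,
    because the two have close lengths and close numbers of other letters. *)
Lemma carry_bound u1 u2 v1 v2 s t :
  small s -> small t -> matched u1 u2 v1 v2 s t ->
  ~~ ((0 < powers u2) && (0 < powers v2)) ->
  (act (spell u2) s).1 <= 2 * C + p * (2 * K).
Proof.
move=> ss st M; have [h1 h2] := suffixes_close ss st M.
have [h3 h4] := suffixes_close st ss (matched_sym M).
case: M => gu gv _ _ _; case: ss => sC _.
have [_ + _] := admissible_carry (admissible_catr gu) sC => hc.
rewrite negb_and -!leqNgt !leqn0 => no_power.
suff : p * powers u2 <= p * (2 * K) by lia.
rewrite leq_pmul2l //.
have := powers_syllables u2; have := powers_syllables v2.
by case/orP: no_power => /eqP; lia.
Qed.

(** If both suffixes contain a power of x, then both prefixes are the same power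
    of the letter x^p, which acts injectively. *)
Lemma matched_powers u1 u2 v1 v2 s t :
  matched u1 u2 v1 v2 s t -> 0 < powers u2 -> 0 < powers v2 ->
  [/\ all is_base u1, all is_base v1, size u1 = size v1 &
      act (spell u2) s = act (spell v2) t].
Proof.
move=> [gu gv uv vu E] u2_gt0 v2_gt0.
have bu := admissible_powers gu u2_gt0; have bv := admissible_powers gv v2_gt0.
have Esize : size u1 = size v1.
  apply/eqP; rewrite eqn_leq uv ?vu //; last by case: (v2) v2_gt0.
  by case: (u2) u2_gt0.
split=> //; move: E; rewrite !spell_cat !act_cat (act_base _ bu) (act_base _ bv) Esize.
case: (act (spell u2) s) (act (spell v2) t) => [c ds] [c' ds'] /= [/eqP].
by rewrite eqn_add2r => /eqP -> ->.
Qed.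

End Carry.

Section Multiplication.
Variables s0 t0 : config.
Hypotheses (s0_digits : all (fun d => d < m) s0.2)
           (t0_digits : all (fun d => d < m) t0.2).

Definition equality_language : set (seq (padded A)) :=
  [set w | [/\ is_convolution w, admissible (track1 w) /\ admissible (track2 w),
               track1 w != [::], track2 w != [::] &
               act (spell (track1 w)) s0 = act (spell (track2 w)) t0]]%classic.

Lemma equality_matched (z w : seq (padded A)) : equality_language (z ++ w) ->
  matched (track1 z) (track1 w) (track2 z) (track2 w) s0 t0.
Proof.
case; rewrite track1_cat track2_cat => Czw [g1 g2] _ _ E; split=> //.
  by move=> n2; rewrite (size_track2_full Czw n2) size_track1.
by move=> n1; rewrite (size_track1_full Czw n1) size_track2.
Qed.

(** All that two configurations still have to settle to their left: their counters,
    and the digits of one side that the other has not emitted yet.  By truncated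
    subtraction at most one of the two digit words is nonempty. *)
Definition overhang s t : nat * nat * (seq nat * seq nat) :=
  (s.1, t.1, (take (size s.2 - size t.2) s.2, take (size t.2 - size s.2) t.2)).

(** When both suffixes contain powers of x the counters are unbounded, but the two
    configurations must be equal and need not be remembered. *)
Definition equality_class (w : seq (padded A)) :=
  (admissible_class (track1 w), admissible_class (track2 w),
   if (0 < powers (track1 w)) && (0 < powers (track2 w)) then None
   else Some (overhang (act (spell (track1 w)) s0) (act (spell (track2 w)) t0))).

(** The digits common to both sides are already final and must agree. *)
Lemma act_overhang x y s t :
  act x s = act y t <->
  act x ((overhang s t).1.1, (overhang s t).2.1) =
    act y ((overhang s t).1.2, (overhang s t).2.2) /\
  drop (size s.2 - size t.2) s.2 = drop (size t.2 - size s.2) t.2.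
Proof.
case: s t => [c ds] [c' ds']; rewrite /overhang /=.
set i := size ds - size ds'; set j := size ds' - size ds.
have Esize : size (drop i ds) = size (drop j ds') by rewrite !size_drop /i /j; lia.
rewrite -{1}(cat_take_drop i ds) -{1}(cat_take_drop j ds').
rewrite (@act_frame _ _ x c (_ ++ _)) (@act_frame _ _ y c' (_ ++ _)).
rewrite (@act_frame _ _ x c (take _ _)) (@act_frame _ _ y c' (take _ _)).
rewrite !catA /=; set e := _ ++ take _ _; set e' := _ ++ take _ _.
move: e e' => e e'; split=> [[-> /eqP]|[[-> ->] ->] //].
by rewrite -(inj_eq (can_inj revK)) !rev_cat eqseq_cat ?size_rev //
           !(inj_eq (can_inj revK))
  => /andP[/eqP -> /eqP ->].
Qed.

Let letter_bound := \max_a (2 * m * size (spelling a)) + s0.1 + t0.1.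
Let digit_bound := size s0.2 + size t0.2.
Let shift := 3 + 2 * letter_bound + digit_bound.

Lemma regular_equality : regular equality_language.
Proof.
have spelling_le a : 2 * m * size (spelling a) <= letter_bound.
  by rewrite /letter_bound -addnA; apply: leq_trans (leq_addr _ _); apply: leq_bigmax.
have small_s0 : small letter_bound digit_bound s0.
  by split; rewrite /letter_bound /digit_bound; lia.
have small_t0 : small letter_bound digit_bound t0.
  by split; rewrite /letter_bound /digit_bound; lia.
pose carries := iota 0 (2 * letter_bound + p * (2 * shift)).+1.
pose words := digit_words m ((shift + 2) * H + digit_bound).
pose overhangs := [seq (c, e) | c <- [seq (c, c') | c <- carries, c' <- carries],
                                e <- [seq (e, e') | e <- words, e' <- words]].
pose classes := [seq (g, o) |
  g <- [seq (g, g') | g <- admissible_classes, g' <- admissible_classes],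
  o <- None :: [seq Some o | o <- overhangs]].
apply: (@regular_left_classes _ _ _ equality_class classes).
  move=> z w Xzw; have M := equality_matched Xzw.
  have [g1 g2] : admissible (track1 w) /\ admissible (track2 w).
    by case: M => /admissible_catr ? /admissible_catr ?.
  apply: allpairs_f; first by apply: allpairs_f; apply: admissible_class_bounded.
  rewrite inE; case: ifPn => //= no_power; apply: map_f.
  have M' := matched_sym M; have no_power' := no_power; rewrite andbC in no_power'.
  have hc := carry_bound spelling_le small_s0 small_t0 M no_power.
  have hc' := carry_bound spelling_le small_t0 small_s0 M' no_power'.
  have ho := overhang_bound spelling_le small_s0 small_t0 M.
  have ho' := overhang_bound spelling_le small_t0 small_s0 M'.
  rewrite -/shift in hc hc' ho ho'.
  have in_words k (e : seq nat) : k <= (shift + 2) * H + digit_bound ->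
      all (fun d => d < m) e -> take k e \in words.
    move=> hk /allP e_ltm; rewrite mem_digit_words; apply/andP; split.
      by rewrite (leq_trans _ hk) // size_take; case: ltnP.
    by apply/allP => d /mem_take /e_ltm.
  apply: allpairs_f; apply: allpairs_f.
  - by rewrite mem_iota /= add0n ltnS.
  - by rewrite mem_iota /= add0n ltnS.
  - by apply: in_words => //; apply: act_digits.
  - by apply: in_words => //; apply: act_digits.
move=> y z w w' Xyw' E Xzw; have /= E1 := congr1 (fun k => k.1.1) E.
have /= E2 := congr1 (fun k => k.1.2) E; have /= Eo := congr1 snd E.
have M := equality_matched Xzw; have M' := equality_matched Xyw'.
have [Cyw' [g1' g2'] _ _ _] := Xyw'; have [Czw [g1 g2] n1 n2 Ezw] := Xzw.
rewrite !track1_cat !track2_cat in g1 g2 g1' g2' n1 n2 Ezw.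
have ohead_nil (T : eqType) (u v : seq T) :
    ohead u = ohead v -> (u == [::]) = (v == [::]).
  by case: u v => [|? ?] [].
have nil_cat (T : eqType) (u v : seq T) :
  (u ++ v == [::]) = (u == [::]) && (v == [::]) by case: u.
have Nil1 := ohead_nil _ _ _ (congr1 fst E1).
have Nil2 := ohead_nil _ _ _ (congr1 fst E2).
split; rewrite ?track1_cat ?track2_cat.
- exact: is_convolution_subst (is_convolution_catr Cyw') Nil1 Nil2 Czw.
- split; [apply: admissible_subst E1 g1 | apply: admissible_subst E2 g2];
    by apply: admissible_catr; eassumption.
- by move: n1; rewrite !nil_cat Nil1.
- by move: n2; rewrite !nil_cat Nil2.
move: Eo; case: ifP => [/andP[p1 p2]|_]; case: ifP => [/andP[p1' p2']|_] //.
  move=> _; have [b1 b2 Esize _] := matched_powers M p1 p2.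
  have [_ _ _ E'] := matched_powers M' p1' p2'.
  by rewrite !spell_cat !act_cat E' (act_base _ b1) (act_base _ b2) Esize.
case: M' => _ _ _ _; rewrite !spell_cat !act_cat => Eyw' [].
move: Ezw; rewrite !spell_cat !act_cat => /act_overhang[core _].
move: Eyw' => /act_overhang[_ tails] Ec Ec' Ee Ee'.
by apply/act_overhang; split=> //; move: core; rewrite /overhang /= Ec Ec' Ee Ee'.
Qed.

End Multiplication.

End BalancedWords.

(** * Every element of the subsemigroup has an admissible word *)

(** Take the least element of V in each residue class modulo W that meets V. *)
Lemma bounded_residues (V : nat -> Prop) (W : nat) : 0 < W ->
  exists B, forall e, V e -> exists e' i, [/\ V e', e' <= B & e = W * i + e'].
Proof.
move=> W_gt0; suff [B hB] : exists B, forall e, V e -> e %% W < W ->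
    exists e' i, [/\ V e', e' <= B & e = W * i + e'].
  by exists B => e Ve; apply: hB; rewrite ?ltn_pmod.
elim: {2}W => [|k [B IH]]; first by exists 0.
have [[e1 [Ve1 Ee1]]|none] := pselect (exists e, V e /\ e %% W = k); last first.
  exists B => e Ve; rewrite ltnS leq_eqVlt => /orP[/eqP Ee|]; last exact: IH.
  by case: none; exists e.
have exV : exists e, `[< V e >] && (e %% W == k).
  by exists e1; rewrite Ee1 eqxx andbT; apply/asboolP.
case: (ex_minnP exV) => e0 /andP[/asboolP Ve0 /eqP Ee0] e0_min.
exists (maxn B e0) => e Ve; rewrite ltnS leq_eqVlt => /orP[/eqP Ee|lt_ek].
  exists e0, (e %/ W - e0 %/ W); split; rewrite ?leq_maxr //.
  have le_e0 : e0 <= e by apply: e0_min; rewrite Ee eqxx andbT; apply/asboolP.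
  have := leq_div2r W le_e0; have := divn_eq e W; have := divn_eq e0 W.
  by rewrite Ee Ee0; nia.
have [e' [i [Ve' le_e' ->]]] := IH e Ve lt_ek.
by exists e', i; split; rewrite // leq_max le_e'.
Qed.

Section Subsemigroup.
Variables (m n : nat) (P : pred (baumslag_solitar m n)) (T : subSemigroupType P).
Hypotheses (m_gt0 : 0 < m) (lt_nm : n < m).
Local Notation act := (act m n).

(** Locked, since otherwise simplification exposes the first letter. *)
Definition rep (t : T) : seq bool :=
  locked (seq_of_word (repr (val t : presented (bs_relation m n)))).

Lemma act_repM (t t' : T) s :
  act (rep (t * t')%g) s = act (rep t) (act (rep t') s).
Proof.
rewrite -act_cat /rep -!lock -seq_of_wordM; apply: act_congruence => //.
by apply/presented_eqP; rewrite reprK valM.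
Qed.

Lemma rep_inj (t t' : T) : act (rep t) origin = act (rep t') origin -> t = t'.
Proof.
rewrite /rep -!lock => /act_origin_inj /presented_eqP; rewrite !reprK.
exact: val_inj.
Qed.

Lemma act_eval (A : finType) (f : A -> T) (u : word A) s :
  act (rep (eval f u)) s = act (spell (fun a => rep (f a)) u) s.
Proof.
case: u => a u; rewrite /eval /= act_cat.
elim: u (f a) => [|b u IHu] t; first by [].
by rewrite /= IHu act_repM act_cat.
Qed.

Lemma finite_letters (box : seq config) :
  exists letters : seq T, forall t, (t \in letters) = (act (rep t) origin \in box).
Proof.
elim: box => [|x box [letters IH]]; first by exists [::].
have [[t0 Et0]|none] := pselect (exists t, act (rep t) origin = x).
  exists (t0 :: letters) => t; rewrite !inE IH -Et0; congr orb.
  by apply/eqP/eqP => [->|/rep_inj].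
exists letters => t; rewrite inE IH; case: eqP => // Ex.
by case: none; exists t.
Qed.

(** The e such that x^e is 1 or lies in T. *)
Definition exponent (e : nat) : Prop :=
  e = 0 \/ exists t, act (rep t) origin = (e, [::]).

Lemma exponent_rep (t : T) e : act (rep t) origin = (e, [::]) ->
  height (rep t) = 0 /\ size (rep t) = e.
Proof.
move=> E; have h0 : height (rep t) = 0.
  by have := size_act m n (rep t) origin; rewrite E addn0.
by split=> //; move: E; rewrite act_xs // => -[].
Qed.

Lemma exponentD e e' : exponent e -> exponent e' -> exponent (e + e').
Proof.
case=> [-> //|[t Et]]; case=> [->|[t' Et']]; first by rewrite addn0; right; exists t.
right; exists (t * t')%g; rewrite act_repM Et'.
have [h0 <-] := exponent_rep Et.
by rewrite act_xs //= addnC.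
Qed.

Lemma exponentM k e : exponent e -> exponent (k * e).
Proof.
by move=> Ve; elim: k => [|k IHk]; [left|rewrite mulSn; apply: exponentD].
Qed.

(** When T contains no power of x, any p > 0 serves: no letter will spell x^p. *)
Lemma unit_exponent : exists2 p, 0 < p &
  exponent p \/ forall e, exponent e -> e = 0.
Proof.
have [[e [Ve e_neq0]]|none] := pselect (exists e, exponent e /\ e <> 0).
  by exists e; [rewrite lt0n; apply/eqP|left].
exists 1 => //; right=> e Ve; have [->//|/eqP e_neq0] := eqVneq e 0.
by case: none; exists e.
Qed.

Section NormalForm.
Variables (G : finType) (g : G -> T) (A : finType) (f : A -> T).
Variables (p H B C : nat).
Hypotheses (p_gt0 : 0 < p) (H_gt0 : 0 < H).
Hypothesis p_exponent : exponent p \/ forall e, exponent e -> e = 0.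
Hypothesis height_le : forall i, height (rep (g i)) <= H.
Hypothesis B_residues : forall e, exponent e ->
  exists e' i, [/\ exponent e', e' <= B & e = p * m ^ H * i + e'].
Hypothesis C_ge : forall i, m * B + 2 * m * size (rep (g i)) <= C.
Hypothesis letters_le : forall a, (act (rep (f a)) origin).1 <= C.
Hypothesis letters_exist : forall t,
  (act (rep t) origin).1 <= C -> height (rep t) <= 3 * H -> exists a, f a = t.

Local Notation spelling := (fun a => rep (f a)).
Local Notation powers := (count (is_power spelling)).

(** By induction from the right.  When a generator g of positive height is put in
    front of x^e c, write e = p m^H i + e'.  The multiple of p m^H passes to the
    left of g, as H bounds the height of g, and x^e' is absorbed by g.  The new
    element is a letter of its own if c is as high as its length asks, and
    otherwise it is merged with the first letter of c.  By contraction the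
    merged letters remain in the finite set with counter at most C. *)
Lemma normal_form (w : seq G) : exists e c,
  [/\ exponent e, admissible spelling p H c, powers c = 0 &
      act (spell (fun i => rep (g i)) w) origin =
      ((act (spell spelling c) origin).1 + e, (act (spell spelling c) origin).2)].
Proof.
elim: w => [|i w [e [c [Ve gc c_pos Ew]]]].
  by exists 0, [::]; split=> //; left.
rewrite spell_cons act_cat Ew.
set x := act (spell spelling c) origin.
have [h0|h_gt0] := posnP (height (rep (g i))).
  exists (e + size (rep (g i))), c; split=> //.
    by apply: exponentD => //; right; exists (g i); rewrite act_xs.
  by rewrite act_xs //= addnA.
have [e' [j [Ve' le_e'B Ee]]] := B_residues Ve.
have [g' Eg'] : exists g' : T, forall s,
    act (rep g') s = act (rep (g i)) (s.1 + e', s.2).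
  case: Ve' => [->|[t Et]].
    by exists (g i) => s; rewrite addn0 -surjective_pairing.
  exists (g i * t)%g => s; rewrite act_repM.
  by have [t0 <-] := exponent_rep Et; rewrite (act_xs _ _ _ t0).
have hg' : height (rep g') = height (rep (g i)).
  by have := size_act m n (rep g') origin; rewrite Eg' size_act /= !addn0.
have g'_le s : s.1 <= C -> (act (rep g') s).1 <= C.
  move=> sC; have := act_contract m_gt0 lt_nm (s.1 + e', s.2) h_gt0.
  rewrite -Eg' /=; have := C_ge i; nia.
(* The exponent of x that leaves g on its left. *)
pose e1 := n ^ height (rep (g i)) * (p * m ^ (H - height (rep (g i))) * j).
have Ve1 : exponent e1.
  rewrite /e1; case: p_exponent => [Vp|V0].
    have -> : n ^ height (rep (g i)) * (p * m ^ (H - height (rep (g i))) * j) =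
      n ^ height (rep (g i)) * m ^ (H - height (rep (g i))) * j * p by lia.
    exact: exponentM.
  suff -> : j = 0 by rewrite !muln0; left.
  have := V0 e Ve; have : 0 < p * m ^ H by rewrite muln_gt0 p_gt0 expn_gt0 m_gt0.
  nia.
have Eact : act (rep (g i)) (x.1 + e, x.2) =
    ((act (rep g') x).1 + e1, (act (rep g') x).2).
  rewrite Ee Eg'.
  have -> : x.1 + (p * m ^ H * j + e') = (x.1 + e') +
      m ^ height (rep (g i)) * (p * m ^ (H - height (rep (g i))) * j).
    rewrite -{1}(subnKC (height_le i)) expnD; lia.
  by rewrite (act_shift _ m_gt0).
rewrite Eact.
suff [c' [gc' c'_pos Ec']] : exists c', [/\ admissible spelling p H c', powers c' = 0 &
    forall s, act (spell spelling c') s = act (rep g') (act (spell spelling c) s)].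
  by exists e1, c'; split=> //; rewrite Ec'.
have [hi lo] := admissible_height gc; have Esize := powers_syllables spelling c.
rewrite c_pos add0n in Esize; rewrite Esize in hi lo.
have no_start d : powers d = 0 -> starts_with_power spelling d = false.
  by case: d => //= b d; case: is_power.
have h_le : height (rep g') <= H by rewrite hg'.
have not_power a t : f a = t -> 0 < height (rep t) -> is_power spelling a = false.
  by move=> <- h; rewrite /is_power eqn0Ngt h.
(* Below full height the new letter is merged; otherwise it stands alone.
   Either way the first suffix stays balanced and the others are unchanged. *)
have [full|room] := leqP (size c * H) (height (spell spelling c)).
  have [a Ea] : exists a, f a = g' by apply: letters_exist; [apply: g'_le|lia].
  have pos_a : is_power spelling a = false by apply: not_power Ea _; rewrite hg'.
  exists (a :: c); split; rewrite /= ?no_start // ?gc ?pos_a //=.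
    by rewrite /balanced spell_cons height_cat Ea /=; lia.
  by move=> s; rewrite spell_cons act_cat Ea.
case: c gc c_pos hi lo Esize room {Ew x Eact} => [//|c1 c2] gc12 c_pos hi lo Esize room.
have /and3P[gc2 _ _] := gc12.
have pos_c1 : ~~ is_power spelling c1 by move: c_pos => /=; case: is_power.
have c2_pos : powers c2 = 0 by move: c_pos => /=; case: is_power.
have [_ lo2] := admissible_height gc2; have Esize2 := powers_syllables spelling c2.
rewrite c2_pos add0n in Esize2; rewrite Esize2 in lo2.
have h12 : height (rep (g' * f c1)%g) = height (rep g') + height (rep (f c1)).
  have := size_act m n (rep (g' * f c1)%g) origin.
  by rewrite act_repM !size_act /= !addn0.
rewrite spell_cons height_cat /= in hi lo room.
have [a Ea] : exists a, f a = (g' * f c1)%g.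
  apply: letters_exist; first by rewrite act_repM; apply: g'_le; apply: letters_le.
  rewrite h12; lia.
have pos_a : is_power spelling a = false by apply: not_power Ea _; rewrite h12 hg'; lia.
exists (a :: c2); split; rewrite /= ?no_start // ?gc2 ?pos_a //=.
  by apply/and3P; split=> //; rewrite /balanced spell_cons height_cat Ea h12 /=; lia.
by move=> s; rewrite !spell_cons !act_cat Ea act_repM.
Qed.

End NormalForm.

(** The alphabet is the set of elements of T whose output has counter at most C
    and at most 3 H digits.  The bound 3 H is what balance leaves for one letter:
    a word of k + 1 letters has height at most (k + 2) H, and its last k letters
    have height at least (k - 1) H. *)
Lemma cross_section (G : finType) (g : G -> T) : generating g ->
  exists (A : finType) (f : A -> T) (p H : nat), [/\ 0 < p, 0 < H &
    forall t, exists2 u : word A,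
      admissible (fun a => rep (f a)) p H u & eval f u = t].
Proof.
move=> gen_g; have [p p_gt0 p_exponent] := unit_exponent.
pose H := (\max_i height (rep (g i))).+1.
have height_le i : height (rep (g i)) <= H by apply/leqW/leq_bigmax.
have pmH_gt0 : 0 < p * m ^ H by rewrite muln_gt0 p_gt0 expn_gt0 m_gt0.
have [B B_residues] := bounded_residues exponent pmH_gt0.
have [B' B'_residues] := bounded_residues exponent p_gt0.
pose C := m * B + 2 * m * \max_i size (rep (g i)) + B' + p.
have C_ge i : m * B + 2 * m * size (rep (g i)) <= C.
  have : size (rep (g i)) <= \max_i size (rep (g i)) by apply: leq_bigmax.
  rewrite /C; nia.
have [letters lettersE] :=
  finite_letters [seq (c, ds) | c <- iota 0 C.+1, ds <- digit_words m (3 * H)].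
pose A : finType := seq_sub letters; pose f (a : A) : T := ssval a.
have letters_le a : (act (rep (f a)) origin).1 <= C.
  have := ssvalP a; rewrite lettersE => /allpairsP[[c ds] [+ _ ->]].
  by rewrite mem_iota /= add0n ltnS.
have letters_exist t :
    (act (rep t) origin).1 <= C -> height (rep t) <= 3 * H -> exists a, f a = t.
  move=> tC tH; suff t_in : t \in letters by exists (SeqSub t_in).
  rewrite lettersE [act _ _]surjective_pairing; apply: allpairs_f.
    by rewrite mem_iota /= add0n ltnS.
  by rewrite mem_digit_words size_act addn0 tH; apply: act_digits.
exists A, f, p, H; split=> // t.
have power_letter e : exponent e -> 0 < e -> e <= C -> exists a : A,
    height (rep (f a)) = 0 /\ size (rep (f a)) = e.
  case=> [-> //|[t' Et'] _ e_le]; have [h0 sz] := exponent_rep Et'.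
  have [a Ea] : exists a, f a = t' by apply: letters_exist; rewrite ?Et' ?h0.
  by exists a; rewrite Ea.
have [w Ew] := gen_g t.
have [e [c [Ve gc c_pos]]] := normal_form p_gt0 (isT : 0 < H) p_exponent height_le
  B_residues C_ge letters_le letters_exist w.
rewrite -act_eval Ew => Et.
have [e' [N [Ve' le_e' Ee]]] := B'_residues e Ve.
pose spelling a : seq bool := rep (f a).
have [d [gd Ed]] : exists d, admissible spelling p H d /\
    forall s, act (spell spelling d) s =
      ((act (spell spelling c) s).1 + e', (act (spell spelling c) s).2).
  have [->|e'_gt0] := posnP e'.
    by exists c; split=> // s; rewrite addn0 -surjective_pairing.
  have [|a [ha sa]] := power_letter e' Ve' e'_gt0; first by rewrite /C; lia.
  exists (a :: c); split; last first.
    by move=> s; rewrite spell_cons act_cat act_xs ?sa.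
  rewrite /= gc /is_power ha /=.
  by case: (c) c_pos => //= b c'; rewrite /is_power; case: eqP.
have [u [gu Eu]] : exists u, admissible spelling p H u /\
    act (spell spelling u) origin = act (rep t) origin.
  have [N0|N_gt0] := posnP N.
    by exists d; rewrite Ed Et Ee N0 muln0.
  have Vp : exponent p by case: p_exponent => // /(_ e Ve); nia.
  have [|z [hz sz]] := power_letter p Vp p_gt0; first by rewrite /C; lia.
  have base_z : is_base spelling p z by rewrite /is_base /is_power hz sz !eqxx.
  exists (nseq N z ++ d); split.
    elim: {N_gt0 Ee} N => //= N ->; rewrite /is_power hz /=.
    by rewrite base_z implybT.
  rewrite spell_cat act_cat (act_base (p := p)) ?all_nseq ?base_z ?orbT //.
  by rewrite Ed Et size_nseq Ee /= -addnA [e' + _]addnC.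
case: u gu Eu => [_|a u gu Eu].
  by move=> /esym /act_eq_origin; rewrite /rep -lock.
by exists (Word a u) => //; apply: rep_inj; rewrite act_eval -Eu.
Qed.

End Subsemigroup.

Theorem theorem4p2 (m n : nat) (m_gt0 : 0 < m) (n_gt0 : 0 < n) (lt_nm : n < m)
    (P : pred (baumslag_solitar m n)) (T : subSemigroupType P) :
  finitely_generated T -> right_automatic T.
Proof.
case=> G [g /(cross_section m_gt0 lt_nm)[A [f [p [H [p_gt0 H_gt0 sectionP]]]]]].
pose spelling (a : A) : seq bool := rep (f a).
pose L : set (word A) := [set u | admissible spelling p H u]%classic.
exists A, f, L; split.
- by move=> t; have [u _ Eu] := sectionP t; exists u.
- rewrite (_ : image _ _ = [set u | u != [::] /\ admissible spelling p H u]%classic).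
    exact: regular_admissible.
  apply/seteqP; split=> [_ [u Lu <-] //|[|a u] [] // _ gu].
  by exists (Word a u).
- apply/seteqP; split=> // t _; have [u gu Eu] := sectionP t.
  by exists u.
move=> b; pose s0 := if b is Some a then act m n (spelling a) origin else origin.
rewrite (_ : mul_language f L b = equality_language spelling p H m n s0 origin).
  apply: regular_equality => //.
  by rewrite /s0; case: (b) => // a; apply: act_digits.
have evalE (u v : word A) :
    eval f (if b is Some a then (u * letter a)%g else u) = eval f v <->
    act m n (spell spelling u) s0 = act m n (spell spelling v) origin.
  have Eu : act m n (rep (eval f (if b is Some a then (u * letter a)%g else u))) origin =
      act m n (spell spelling u) s0.
    rewrite act_eval // /s0; case: (b) => [a|//].
    by rewrite seq_of_wordM spell_cat act_cat /spell /= cats0.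
  have Ev : act m n (rep (eval f v)) origin = act m n (spell spelling v) origin.
    by rewrite act_eval.
  by rewrite -Eu -Ev; split=> [->|/rep_inj].
apply/seteqP; split=> [_ [u [v [Lu Lv /evalE Euv ->]]]|z [Cz [g1 g2] n1 n2 Euv]].
  by split; rewrite /is_convolution ?track1_convolution ?track2_convolution.
have [u Eu] : exists u : word A, track1 z = u.
  by case: (track1 z) n1 => // a u; exists (Word a u).
have [v Ev] : exists v : word A, track2 z = v.
  by case: (track2 z) n2 => // a v; exists (Word a v).
rewrite Eu Ev in g1 g2 Euv; exists u, v; split=> //; first exact/evalE.
by rewrite -Eu -Ev; apply/eqP.
Qed.
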